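(* If $(G,\gamma)$ is an edge-colored graph with $\ell$ colors $c_1,\dots,c_\ell$, then \[\max_{1\leq i\leq \ell}(\kappa(G_i)-1)\leq \operatorname{wld}(G)\leq\sum_{i=1}^{\ell}(\kappa(G_i)-1).\]
   Context: An edge-colored graph $(G,\gamma)$ is a finite connected graph $G$ with a surjective function $\gamma:E(G)\to\mathcal{C}=\{c_1,\dots,c_\ell\}$ onto a finite nonempty set of colors (not necessarily a proper edge-coloring). For each color $c_i$ let $E_i(G)=\{e\in E(G):\gamma(e)=c_i\}$ and let $G_i$ be the graph with vertex set $V(G)$ and edge set $E_i(G)$; $\kappa(G_i)$ is its number of connected components. For $W\subseteq E(G)$, let $G_i^W$ be the graph with vertex set $V(G)$ and edge set $W\cup E_i(G)$. The set $W$ is color-connecting if $G_i^W$ is connected for every color $c_i\in\mathcal{C}$. The wild number $\operatorname{wld}(G)$ is the minimum size of a color-connecting set. *)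

(* Defs.v *)
From mathcomp Require Import all_boot.

Set Implicit Arguments.
Unset Strict Implicit.
Unset Printing Implicit Defensive.

(* Nothing forces a graph to be simple: parallel edges and loops are allowed,
   an edge being a loop exactly when its set of endpoints is a singleton. *)
Record graph := Graph {
  vertex : finType;
  edge : finType;
  ends : edge -> {set vertex};
  card_ends : forall e : edge, 0 < #|ends e| <= 2
}.

(* In the next three definitions, F : {set edge G} stands for the graph with
   vertex set vertex G and edge set F. *)
Definition adj (G : graph) (F : {set edge G}) : rel (vertex G) :=
  [rel x y | [exists e in F, ends e == [set x; y]]].

Definition connected (G : graph) (F : {set edge G}) : bool :=
  (0 < #|vertex G|) && [forall x, forall y, connect (adj F) x y].

Definition kappa (G : graph) (F : {set edge G}) : nat := n_comp (adj F) predT.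

Lemma adj_sym (G : graph) (F : {set edge G}) : symmetric (adj F).
Proof. by move=> x y; apply: eq_existsb => e; rewrite setUC. Qed.

(* The colors c_1, ..., c_l are the elements of 'I_l. *)
Record edge_colored_graph (l : nat) := EdgeColoredGraph {
  ecg_graph :> graph;
  ecg_connected : connected [set: edge ecg_graph];
  color : edge ecg_graph -> 'I_l;
  color_surj : forall c : 'I_l, exists e, color e = c;
  colors_nonempty : 0 < l
}.

Definition color_class l (G : edge_colored_graph l) (i : 'I_l) : {set edge G} :=
  [set e | color e == i].

Definition color_connecting l (G : edge_colored_graph l) (W : {set edge G}) :
    bool :=
  [forall i : 'I_l, connected (W :|: color_class G i)].

Lemma color_connecting_setT l (G : edge_colored_graph l) :
  color_connecting [set: edge G].
Proof. by apply/forallP => i; rewrite setTU ecg_connected. Qed.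

(* By color_connecting_setT the minimum is taken over a nonempty family, so
   the default value setT of arg min is itself an admissible candidate. *)
Definition wld l (G : edge_colored_graph l) : nat :=
  #|[arg min_(W < [set: edge G] | color_connecting W) #|W| ]|.

Lemma wldP l (G : edge_colored_graph l) :
  (exists2 W : {set edge G}, color_connecting W & #|W| = wld G) /\
  (forall W : {set edge G}, color_connecting W -> wld G <= #|W|).
Proof.
rewrite /wld; case: arg_minnP; first exact: color_connecting_setT.
by move=> W ccW minW; split=> //; exists W.
Qed.

(* Main.v *)
Require Import Defs.
From mathcomp Require Import all_boot.

(** Adding one edge lowers the number of components by at most one, so a
    color-connecting set needs at least [kappa (G_i) - 1] edges for every [i].
    Conversely, as [G] is connected, [G_i] becomes connected after adding
    [kappa (G_i) - 1] well-chosen edges of [G], each joining two components;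
    the union of these sets over all colors is color-connecting. *)

Section Components.

Set Implicit Arguments.
Unset Strict Implicit.

Variable G : graph.
Implicit Types (F W : {set edge G}) (x y : vertex G).

Lemma adj_connect_sym F : connect_sym (adj F).
Proof. exact/sym_connect_sym/adj_sym. Qed.

Lemma ends_pair (e : edge G) : exists x y, ends e = [set x; y].
Proof.
case/andP: (card_ends e) => e_gt0; rewrite leq_eqVlt => /orP[/cards2P|e_lt2].
  by case=> x [y [_ ->]]; exists x, y.
have /cards1P[x ->]: #|ends e| == 1 by rewrite eqn_leq e_gt0 andbT -ltnS.
by exists x, x; rewrite setUid.
Qed.

Lemma adjP F x y :
  reflect (exists2 e, e \in F & ends e = [set x; y]) (adj F x y).
Proof.
apply: (iffP existsP) => [[e /andP[Fe /eqP exy]]|[e Fe exy]]; exists e => //.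
by rewrite Fe exy eqxx.
Qed.

Lemma connect_subset F F' x y :
  F \subset F' -> connect (adj F) x y -> connect (adj F') x y.
Proof.
move=> sFF'; apply: connect_sub => u v /adjP[e Fe euv]; apply: connect1.
by apply/adjP; exists e => //; apply: (subsetP sFF').
Qed.

Lemma connected_subset F F' : F \subset F' -> connected F -> connected F'.
Proof.
move=> sFF' /andP[V_gt0 /forallP cF]; rewrite /connected V_gt0 /=.
apply/forallP => x; apply/forallP => y; apply: connect_subset sFF' _.
by have /forallP := cF x.
Qed.

Lemma kappaE F : kappa F = #|[set r | root (adj F) r == r]|.
Proof.
by rewrite cardsE; apply: eq_card => r; rewrite !inE andbT.
Qed.

Lemma kappa_gt0 F : 0 < #|vertex G| -> 0 < kappa F.
Proof.
case/card_gt0P => x _; rewrite kappaE; apply/card_gt0P.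
by exists (root (adj F) x); rewrite inE root_root //; apply: adj_connect_sym.
Qed.

Lemma kappa_connected F : connected F -> kappa F <= 1.
Proof.
case/andP=> _ /forallP cF; rewrite kappaE; apply/card_le1_eqP => x y.
rewrite !inE => /eqP<- /eqP<-; apply/eqP; have /forallP/(_ x) := cF y.
by rewrite root_connect //; apply: adj_connect_sym.
Qed.

(** Sending a root of [F'] to its root in [F] is injective, because [F]-connected vertices share
    their [F']-root. Strictness holds because this map misses a root of [F]. *)
Lemma ltn_kappa F F' x y : F \subset F' ->
  connect (adj F') x y -> ~~ connect (adj F) x y -> kappa F' < kappa F.
Proof.
move=> sFF' F'xy nFxy; rewrite !kappaE.
have csF := adj_connect_sym F; have csF' := adj_connect_sym F'.
have rootE u v : connect (adj F) u v -> root (adj F') u = root (adj F') v.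
  by move=> /(connect_subset sFF') ?; apply/eqP; rewrite root_connect.
set R' := [set r | root (adj F') r == r].
have injR : {in R' &, injective (root (adj F))}.
  move=> r s; rewrite !inE => /eqP {2}<- /eqP {2}<- /eqP.
  by rewrite root_connect // => /rootE.
rewrite -(card_in_imset injR); apply: proper_card; rewrite properE.
apply/andP; split.
  by apply/subsetP => _ /imsetP[r _ ->]; rewrite inE root_root.
(* Were the map onto, every vertex would be [F]-connected to some [F']-root. The [F']-roots found
   from [x] and from [y] coincide, as [F'] connects [x] to [y]; hence [F] would connect them too. *)
apply: contra nFxy => /subsetP sR.
have hit z : exists2 r, r \in R' & connect (adj F) z r.
  have /imsetP[r R'r /eqP] : root (adj F) z \in root (adj F) @: R'.
    by apply: sR; rewrite inE root_root.
  by rewrite root_connect //; exists r.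
have [[r + Fxr] [s + Fys]] := (hit x, hit y).
rewrite !inE => /eqP rr /eqP ss.
have rs : r = s.
  rewrite -rr -ss -(rootE _ _ Fxr) -(rootE _ _ Fys).
  by apply/eqP; rewrite root_connect.
by rewrite (connect_trans Fxr) // rs csF.
Qed.

(* The map [h] merges the component of [y] into that of [x]; it is constant on
   the components of [e |: F] and fixes every root other than that of [y]. *)
Lemma kappa_setU1 F (e : edge G) : kappa F <= (kappa (e |: F)).+1.
Proof.
have [x [y exy]] := ends_pair e.
have csF := adj_connect_sym F; have csF' := adj_connect_sym (e |: F).
pose h v := root (adj F) (if connect (adj F) y v then x else v).
have hy : h y = root (adj F) x by rewrite /h connect0.
have hx : h x = root (adj F) x by rewrite /h; case: ifP.
have h_adj u v : adj (e |: F) u v -> h u = h v.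
  case/adjP => e'; rewrite in_setU1 => /orP[/eqP->|Fe'] euv.
    have: (u \in ends e) && (v \in ends e) by rewrite euv !inE !eqxx orbT.
    by rewrite exy !inE => /andP[/orP[]/eqP-> /orP[]/eqP->]; rewrite ?hx ?hy.
  have Fuv : connect (adj F) u v by apply/connect1/adjP; exists e'.
  rewrite /h (same_connect_r csF Fuv); case: ifP => // _.
  by apply/eqP; rewrite root_connect.
have h_connect u v : connect (adj (e |: F)) u v -> h u = h v.
  case/connectP => p; elim: p u => [|w p IHp] u /= => [_ ->//|/andP[uw pw] vE].
  by rewrite (h_adj _ _ uw); apply: IHp.
(* Discarding the root of [y] accounts for the successor. On the remaining roots [h] is the identity
   and factors through the components of [e |: F], so these roots lie in distinct components. *)
rewrite !kappaE (cardsD1 (root (adj F) y)) -addn1 addnC leq_add ?leq_b1 //.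
have h_root r : r \in [set r | root (adj F) r == r] :\ root (adj F) y -> h r = r.
  rewrite !inE => /andP[ry /eqP rr]; rewrite /h -root_connect // rr eq_sym.
  by rewrite (negPf ry).
have injR : {in [set r | root (adj F) r == r] :\ root (adj F) y &,
    injective (root (adj (e |: F)))}.
  move=> r s Rr Rs /eqP; rewrite root_connect // => /h_connect.
  by rewrite !h_root.
rewrite -(card_in_imset injR); apply: subset_leq_card.
by apply/subsetP => _ /imsetP[r _ ->]; rewrite inE root_root.
Qed.

Lemma kappa_setU F W : kappa F <= kappa (W :|: F) + #|W|.
Proof.
move: {2}#|W| (erefl #|W|) => n; elim: n W => [|n IHn] W Wn.
  by rewrite (cards0_eq Wn) set0U leq_addr.
have /card_gt0P[e We]: 0 < #|W| by rewrite Wn.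
have WDn : #|W :\ e| = n by move: Wn; rewrite (cardsD1 e) We => -[].
rewrite (leq_trans (IHn _ WDn)) // Wn WDn -addSnnS leq_add2r.
by rewrite -{2}(setD1K We) -setUA kappa_setU1.
Qed.

(** If every edge of [G] stayed inside a component of [F], each path of [G] would too, and [F] would
    inherit connectedness from [G]. *)
Lemma exists_joining_edge F : connected [set: edge G] -> ~~ connected F ->
  exists x y, adj [set: edge G] x y && ~~ connect (adj F) x y.
Proof.
case/andP=> V_gt0 /forallP cG; rewrite /connected V_gt0 /= => ncF.
apply/'exists_existsP; apply: contraR ncF => /existsPn nE.
apply/forallP => x; apply/forallP => y; have /forallP/(_ y) := cG x.
apply: connect_sub => u v Guv; have /existsPn/(_ v) := nE u.
by rewrite Guv negbK.
Qed.

Lemma connecting_set_exists F : connected [set: edge G] ->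
  exists2 W, connected (W :|: F) & #|W| <= kappa F - 1.
Proof.
move=> cG; have V_gt0 : 0 < #|vertex G| by case/andP: cG.
(* Strong induction on [kappa F]: a joining edge makes it drop strictly. *)
have [n] := ubnP (kappa F); elim: n F => // n IHn F leFn.
have [cF|ncF] := boolP (connected F).
  by exists set0; rewrite ?set0U ?cards0.
have [x [y /andP[/adjP[e _ exy] nFxy]]] := exists_joining_edge cG ncF.
have ltF : kappa (e |: F) < kappa F.
  apply: ltn_kappa nFxy; first exact: subsetUr.
  by apply/connect1/adjP; exists e; rewrite ?setU11.
have [W cW leW] := IHn _ (leq_trans ltF leFn).
exists (e |: W); first by rewrite -setUA setUCA.
(* Positivity makes the truncated subtraction exact: [1 + (kappa (e |: F) - 1)] is [kappa (e |: F)],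
   which is below [kappa F]. *)
have F'_gt0 := kappa_gt0 (e |: F) V_gt0.
rewrite cardsU1 (leq_trans (leq_add (leq_b1 _) leW)) // subnKC //.
by rewrite subn1 -ltnS prednK // (leq_trans _ ltF).
Qed.

End Components.

Theorem proposition5p1 (l : nat) (G : edge_colored_graph l) :
  \max_(i < l) (kappa (color_class G i) - 1) <= wld G
    <= \sum_(i < l) (kappa (color_class G i) - 1).
Proof.
have [[W /forallP cW <-] wld_min] := wldP G; apply/andP; split.
  (* For a minimum color-connecting [W], the graph [W :|: color_class G i] has at most one
     component. *)
  apply/bigmax_leqP => i _; rewrite leq_subLR.
  apply: leq_trans (kappa_setU _ W) _; rewrite leq_add2r.
  exact: kappa_connected.
have cex i : exists W : {set edge G}, connected (W :|: color_class G i) &&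
    (#|W| <= kappa (color_class G i) - 1).
  have [V cV leV] := connecting_set_exists (color_class G i) (ecg_connected G).
  by exists V; rewrite cV.
pose V i := xchoose (cex i).
have VP i := andP (xchooseP (cex i)).
have cV : color_connecting (\bigcup_i V i).
  apply/forallP => i; have [cVi _] := VP i.
  by apply: connected_subset cVi; apply/setSU/bigcup_sup.
apply: leq_trans (wld_min _ cV) _.
(* The bound on cardinality by the sum passes through unions, whether or not the sets [V i]
   overlap. *)
elim/big_ind2: _ => [|m A n B leA leB|i _]; first by rewrite cards0.
  exact: leq_trans (leq_card_setU _ _) (leq_add leA leB).
by case: (VP i).
Qed.
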